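(* (Upper bound for testing a change in exactly $p$ components at a known location.) Assume (A1) and (A2). Suppose that $r=r(d)$ satisfies either $$\lim_{d\to\infty}\frac{r^2\,n\,h(\tau)}{\sqrt d}=+\infty \qquad\text{or}\qquad \liminf_{d\to\infty}\frac{r^2\,n\,h(\tau)}{p\log(d/p)}>\varkappa .$$ Let the threshold $H=H(d)$ satisfy $H\to\infty$, $H\ge\sqrt{(\varkappa/2)\log d}$, and $$\limsup_{d\to\infty}\frac{H\sqrt{2d}}{r^2\,n\,h(\tau)}<\sqrt2-1,$$ and for some $\delta>0$ let $$T_p=\frac{\varkappa}{\sqrt{2p}}\log\Bigl[(1+\delta)\binom dp\Bigr].$$ Then the test $\psi_p^*=\psi_{\mathrm{lin}}\vee\psi^p_{\mathrm{scan}}$ (built with these thresholds at the location $\tau$) satisfies $\gamma(\psi_p^*,\Theta_p[r],\tau)\to0$ as $d\to\infty$.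
   Context: Model: for integers $n\ge2$, $d\ge1$ and a fixed baseline mean $\theta\in\mathbb R^d$, we observe independent vectors $X_i=\theta+\Delta\theta_\tau\mathbf 1\{i>\tau\}+\xi_i$, $i=1,\dots,n$, with $\xi_i$ i.i.d. $\mathcal N(0,I_d)$, change location $\tau$ and jump $\Delta\theta_\tau\in\mathbb R^d$. $\mathbf E_0$ denotes expectation under the null (no change, $\Delta\theta_\tau=0$) and $\mathbf E_{\Delta\theta_\tau}$ expectation when there is a jump $\Delta\theta_\tau$ at location $\tau$. For $p\in\{1,\dots,d\}$, $V_p^d=\{(\varepsilon_1v_1,\dots,\varepsilon_dv_d):v\in\mathbb R^d,\ \varepsilon_j\in\{0,1\},\ \sum_j\varepsilon_j=p\}$, $\Theta_p[r]=\{v\in V_p^d:\|v\|\ge r\}$ ($\|\cdot\|$ Euclidean norm). $h(\tau)=\frac\tau n(1-\frac\tau n)$. For $s\in\{1,\dots,n-1\}$, $Z_n(s)=\sqrt{\frac{s(n-s)}n}\bigl(\frac1s\sum_{i=1}^sX_i-\frac1{n-s}\sum_{i=s+1}^nX_i\bigr)\in\mathbb R^d$. $\mathcal M(d,p)$ is the family of subsets of $\{1,\dots,d\}$ of cardinality $p$, and for $m\subseteq\{1,\dots,d\}$, $\Pi_m v$ is the vector obtained from $v$ by setting to zero all coordinates outside $m$. Statistics: $L_{\mathrm{lin}}(s)=(\|Z_n(s)\|^2-d)/\sqrt{2d}$ and $L^p_{\mathrm{scan}}(s)=\max_{m\in\mathcal M(d,p)}(\|\Pi_mZ_n(s)\|^2-p)/\sqrt{2p}$.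 Tests: $\psi_{\mathrm{lin}}=\mathbf 1\{L_{\mathrm{lin}}(\tau)>H\}$, $\psi^p_{\mathrm{scan}}=\mathbf 1\{L^p_{\mathrm{scan}}(\tau)>T_p\}$, $\psi_p^*=\max(\psi_{\mathrm{lin}},\psi^p_{\mathrm{scan}})$. For a test $\psi$ (a measurable function of $X_1,\dots,X_n$ with values in $[0,1]$): $\alpha(\psi)=\mathbf E_0\psi$, $\beta(\psi,\Theta_p[r],\tau)=\sup_{\Delta\theta_\tau\in\Theta_p[r]}\mathbf E_{\Delta\theta_\tau}(1-\psi)$, $\gamma(\psi,\Theta_p[r],\tau)=\alpha(\psi)+\beta(\psi,\Theta_p[r],\tau)$. $\varkappa$ is a fixed constant with $\varkappa>2/(1-\log2)$ ($\approx6.52$). Asymptotic framework: $n,p,r,\tau,H,T_p$ are all sequences indexed by $d$, and limits are as $d\to\infty$. Assumption (A1): $n=n(d)\to\infty$. Assumption (A2): $p\to\infty$ and $d/p\to\infty$. *)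

(* Defs.v *)
From HB Require Import structures.
From mathcomp Require Import all_boot all_order all_algebra.
From mathcomp Require Import all_classical all_reals all_analysis.
Set Implicit Arguments. Unset Strict Implicit. Unset Printing Implicit Defensive.
Import Order.TTheory GRing.Theory Num.Theory.
Local Open Scope ring_scope.

Section ChangePoint.
Variable R : realType.

Definition sqnorm (d : nat) (v : 'rV[R]_d) : R := \sum_(j < d) v 0 j ^+ 2.
Definition enorm (d : nat) (v : 'rV[R]_d) : R := Num.sqrt (sqnorm v).

Definition projm (d : nat) (m : {set 'I_d}) (v : 'rV[R]_d) : 'rV[R]_d :=
  \row_j (if j \in m then v 0 j else 0).

Definition hfun (n tau : nat) : R := (tau%:R / n%:R) * (1 - tau%:R / n%:R).

(* Z_n(s); rows 0..n-1 of X are X_1..X_n, so "i <= s" (1-based) is "i < s" (0-based) *)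
Definition Zn (n d : nat) (X : 'M[R]_(n, d)) (s : nat) : 'rV[R]_d :=
  Num.sqrt (s%:R * (n - s)%:R / n%:R) *:
    ((s%:R)^-1 *: (\sum_(i < n | (i < s)%N) row i X)
     - ((n - s)%:R)^-1 *: (\sum_(i < n | (s <= i)%N) row i X)).

Definition L_lin (d : nat) (z : 'rV[R]_d) : R :=
  (sqnorm z - d%:R) / Num.sqrt (2 * d%:R).

Definition L_scan (d p : nat) (z : 'rV[R]_d) : \bar R :=
  \big[Order.max/-oo%E]_(m : {set 'I_d} | #|m| == p)
     ((sqnorm (projm m z) - p%:R) / Num.sqrt (2 * p%:R))%:E.

Definition psi_lin (n d tau : nat) (H : R) (X : 'M[R]_(n, d)) : R :=
  if H < L_lin (Zn X tau) then 1 else 0.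

Definition psi_scan (n d p tau : nat) (T : R) (X : 'M[R]_(n, d)) : R :=
  if (T%:E < L_scan p (Zn X tau))%E then 1 else 0.

Definition psi_star (n d p tau : nat) (H T : R) (X : 'M[R]_(n, d)) : R :=
  Num.max (psi_lin tau H X) (psi_scan p tau T X).

(* Iterated integral against N independent standard normal coordinates:
   gexp N f = E f(xi_1,...,xi_N) with xi_k iid N(0,1). *)
Fixpoint gexp (N : nat) (f : seq R -> \bar R) : \bar R :=
  match N with
  | 0 => f [::]
  | N'.+1 => (\int[normal_prob (0:R) 1]_x gexp N' (fun s => f (x :: s)))%E
  end.

(* observations X_i = theta + Delta 1{i > tau} + xi_i (i 1-based; row i is X_{i+1}),
   the noise xi_{i+1,j} being coordinate i*d+j of the Gaussian sample s *)
Definition mkX (n d : nat) (theta Delta : 'rV[R]_d) (tau : nat) (s : seq R)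
  : 'M[R]_(n, d) :=
  \matrix_(i < n, j < d)
    (theta 0 j + (if (tau < i.+1)%N then Delta 0 j else 0) + nth 0 s (i * d + j)).

Definition Eexp (n d : nat) (theta Delta : 'rV[R]_d) (tau : nat)
  (phi : 'M[R]_(n, d) -> R) : \bar R :=
  gexp (n * d) (fun s => (phi (mkX n theta Delta tau s))%:E).

Definition Vpd (d p : nat) : set 'rV[R]_d :=
  [set v | exists m : {set 'I_d}, #|m| = p /\ forall j, j \notin m -> v 0 j = 0].

Definition Theta_p (d p : nat) (r : R) : set 'rV[R]_d :=
  [set v | Vpd p v /\ r <= enorm v].

Definition alpha_err (n d : nat) (theta : 'rV[R]_d) (tau : nat)
  (psi : 'M[R]_(n, d) -> R) : \bar R := Eexp theta 0 tau psi.

Definition beta_err (n d : nat) (theta : 'rV[R]_d) (tau : nat)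
  (psi : 'M[R]_(n, d) -> R) (Th : set 'rV[R]_d) : \bar R :=
  ereal_sup [set Eexp theta D tau (fun X => 1 - psi X) | D in Th].

Definition gamma_err (n d : nat) (theta : 'rV[R]_d) (tau : nat)
  (psi : 'M[R]_(n, d) -> R) (Th : set 'rV[R]_d) : \bar R :=
  (alpha_err theta tau psi + beta_err theta tau psi Th)%E.

End ChangePoint.

(* Main.v *)
(** All the probabilities are bounded by the exponential Markov inequality.  The
    coordinates of [Z_n(tau)] are independent unit-variance Gaussians with means
    [b_j = - sqrt (n h(tau)) Delta_j], and for [l < 1/2]
    [E exp (l (b + xi)^2) = (1 - 2 l)^(-1/2) exp (l b^2 / (1 - 2 l))
       <= exp (l / (1 - 2 l) * (1 + b^2))].
    Taking [l = 1 / (4 sqrt d)] bounds the type I error of the linear test by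
    [exp (1/4 - H/4)]; [l = 1/4] and a union bound over the supports handle the
    scan test, since [kappa > 4] and ['C(d, p) >= (d / p)^p].  The condition on
    [limsup] forces [r^2 n h(tau) >= 2 H sqrt (2 d)] eventually, so the linear test
    alone, with [l = - 1 / (4 sqrt d)], makes the type II error at most
    [exp (1/8 - H/12)].  Each indicator is dominated pointwise by its exponential,
    so only the exponentials need to be measurable. *)
Require Import Defs.
From HB Require Import structures.
From mathcomp Require Import all_boot all_order all_algebra.
From mathcomp Require Import all_classical all_reals all_analysis.
From mathcomp Require Import measurable_realfun ring lra.
Set Implicit Arguments. Unset Strict Implicit. Unset Printing Implicit Defensive.
Import Order.TTheory GRing.Theory Num.Theory.
Local Open Scope classical_set_scope.
Local Open Scope ring_scope.

(** * One-dimensional Gaussian integrals *)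

Section GaussianIntegral.
Context {R : realType}.

(** The integral of a nonnegative function is a supremum over nonnegative simple functions below it,
    so monotonicity holds without measurability. This is what lets the tests be bounded
    pointwise. *)
Lemma ge0_le_integralT (d : measure_display) (T : measurableType d)
    (mu : {measure set T -> \bar R}) (f g : T -> \bar R) :
  (forall x, 0 <= f x)%E -> (forall x, f x <= g x)%E ->
  (\int[mu]_x f x <= \int[mu]_x g x)%E.
Proof.
move=> f0 fg; have g0 x : (0 <= g x)%E by exact: le_trans (fg x).
rewrite !ge0_integralTE//; apply: ereal_sup_le => _ [h hf <-].
by exists h => // x; exact: le_trans (fg x).
Qed.

(** The Radon-Nikodym derivative of [normal_prob] agrees almost everywhere with [normal_pdf],
    because both have the same integral over every measurable set. *)
Lemma ge0_integral_normal_prob (m s : R) (f : measurableTypeR R -> \bar R) :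
  measurable_fun setT f -> (forall x, 0 <= f x)%E ->
  (\int[normal_prob m s]_x f x =
   \int[lebesgue_measure]_x (f x * (normal_pdf m s x)%:E))%E.
Proof.
move=> mf f0; have dom := normal_prob_dominates m s.
have intf := Radon_Nikodym_SigmaFinite.f_integrable dom.
have mpdf : measurable_fun setT (fun x : measurableTypeR R => (normal_pdf m s x)%:E).
  by apply/measurable_EFinP; exact: measurable_normal_pdf.
rewrite -(Radon_Nikodym_SigmaFinite.change_of_variables dom)//.
apply: ge0_ae_eq_integral => //.
- by apply: emeasurable_funM => //; exact: measurable_int intf.
- exact: emeasurable_funM.
- by move=> x _; rewrite mule_ge0// Radon_Nikodym_SigmaFinite.f_ge0.
- by move=> x _; rewrite mule_ge0// lee_fin normal_pdf_ge0.
- apply: ae_eqe_mul2l; apply: integral_ae_eq => // E _ mE.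
  by rewrite -Radon_Nikodym_SigmaFinite.f_integral.
Qed.

Lemma measurable_expR_sqr (l a b : R) :
  measurable_fun setT (fun x : measurableTypeR R => expR (l * (b + a * x) ^+ 2)).
Proof.
apply: measurableT_comp => //; apply: measurable_funM => //.
apply: measurable_funX; apply: measurable_funD => //.
Qed.

(* Completing the square turns the integrand into a multiple of another
   normal density. *)
Lemma integral_normal_expR_sqr (l a b : R) : 0 < 1 - 2 * l * a ^+ 2 ->
  (\int[normal_prob (0 : R) 1]_x (expR (l * (b + a * x) ^+ 2))%:E =
   ((Num.sqrt (1 - 2 * l * a ^+ 2))^-1 *
    expR (l * b ^+ 2 / (1 - 2 * l * a ^+ 2)))%:E)%E.
Proof.
set D : R := 1 - _ => D0; set K := _ * expR _.
have sD0 : 0 < Num.sqrt D by rewrite sqrtr_gt0.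
have K0 : 0 <= K by rewrite mulr_ge0 ?expR_ge0// invr_ge0 ltW.
rewrite ge0_integral_normal_prob; last 2 first.
- by apply/measurable_EFinP; exact: measurable_expR_sqr.
- by move=> x; rewrite lee_fin expR_ge0.
(* Mean and standard deviation of the tilted density; [K] is its total mass. *)
pose m := 2 * l * a * b / D; pose s := (Num.sqrt D)^-1.
have s0 : s != 0 by rewrite invr_eq0 gt_eqF.
have s2 : s ^+ 2 = D^-1 by rewrite exprVn sqr_sqrtr// ltW.
transitivity (\int[lebesgue_measure]_x (K%:E * (normal_pdf m s x)%:E))%E.
  apply: eq_integral => x _; rewrite -!EFinM; congr EFin.
  rewrite !normal_pdfE ?oner_eq0// /normal_peak /normal_fun s2.
  have -> : D^-1 * pi *+ 2 = D^-1 * ((1 : R) ^+ 2 * pi *+ 2).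
    by rewrite -(mulrnAr D^-1) expr1n mul1r.
  rewrite sqrtrM ?invr_ge0 ?(ltW D0)// sqrtrV ?(ltW D0)// invfM invrK.
  rewrite mulrCA /K; set P := (Num.sqrt (_ *+ 2))^-1; set S := Num.sqrt D.
  rewrite (_ : S^-1 * _ * _ = P * (expR (l * b ^+ 2 / D) *
      expR (- (x - m) ^+ 2 / (D^-1 *+ 2)))); last by field; rewrite gt_eqF.
  rewrite -!expRD; congr (P * expR _).
  have Dn : D != 0 by rewrite gt_eqF.
  by rewrite /m /D expr1n; field.
rewrite ge0_integralZl//.
- by rewrite integral_normal_pdf mule1.
- by apply/measurable_EFinP; exact: measurable_normal_pdf.
- by move=> x _; rewrite lee_fin normal_pdf_ge0.
Qed.

End GaussianIntegral.

(** * Iterated Gaussian expectations of exponentials of quadratic forms *)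

Section GaussianExpectation.
Context {R : realType}.

Lemma gexp_ge0 N (f : seq R -> \bar R) :
  (forall s, 0 <= f s)%E -> (0 <= gexp N f)%E.
Proof.
elim: N f => [|N IH] f f0 /=; first exact: f0.
by apply: integral_ge0 => x _; exact: IH.
Qed.

Lemma le_gexp N (f g : seq R -> \bar R) :
  (forall s, 0 <= f s)%E -> (forall s, f s <= g s)%E -> (gexp N f <= gexp N g)%E.
Proof.
elim: N f g => [|N IH] f g f0 fg /=; first exact: fg.
by apply: ge0_le_integralT => x; [exact: gexp_ge0|exact: IH].
Qed.

(* Measurability of every partial iterated integral: the hypothesis under
   which [gexp] is additive. *)
Fixpoint gmeasurable N (f : seq R -> \bar R) : Prop :=
  if N is N'.+1 then
    (forall x, gmeasurable N' (fun s => f (x :: s))) /\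
    measurable_fun setT (fun x => gexp N' (fun s => f (x :: s)))
  else True.

Lemma gexpD N (f g : seq R -> \bar R) :
  (forall s, 0 <= f s)%E -> (forall s, 0 <= g s)%E ->
  gmeasurable N f -> gmeasurable N g ->
  gmeasurable N (fun s => f s + g s)%E /\
  (gexp N (fun s => f s + g s) = gexp N f + gexp N g)%E.
Proof.
elim: N f g => [//|N IH] f g f0 g0 /= [mf mf'] [mg mg'].
have E x : (gexp N (fun s => f (x :: s) + g (x :: s)) =
    gexp N (fun s => f (x :: s)) + gexp N (fun s => g (x :: s)))%E.
  by apply: (IH _ _ _ _ (mf x) (mg x)).2.
split.
- split=> [x|]; first by apply: (IH _ _ _ _ (mf x) (mg x)).1.
  by under eq_fun do rewrite E; exact: emeasurable_funD.
- under eq_integral do rewrite E.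
  by rewrite ge0_integralD// => x _; exact: gexp_ge0.
Qed.

Lemma gexp_cst0 N : gmeasurable N (fun=> 0%E) /\
  gexp N (fun=> 0%E : \bar R) = 0%E.
Proof.
elim: N => [//|N [m e]] /=; split; last by rewrite e integral0.
by split => //; rewrite e; exact: measurable_cst.
Qed.

Lemma gexp_sum N (I : Type) (r : seq I) (P : pred I) (f : I -> seq R -> \bar R) :
  (forall i s, 0 <= f i s)%E -> (forall i, P i -> gmeasurable N (f i)) ->
  gmeasurable N (fun s => \sum_(i <- r | P i) f i s)%E /\
  (gexp N (fun s => \sum_(i <- r | P i) f i s) = \sum_(i <- r | P i) gexp N (f i))%E.
Proof.
move=> f0 mf; elim: r => [|i r [IHm IHe]].
  by under eq_fun do rewrite big_nil; rewrite big_nil; exact: gexp_cst0.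
under eq_fun do rewrite big_cons.
rewrite big_cons; case: ifPn => Pi //.
rewrite -IHe; apply: gexpD => //; last exact: mf.
by move=> s; exact: sume_ge0.
Qed.

(* Coordinate [k] carries weight [a k] in the linear form number [c k]
   and none in the others. *)
Definition class_weight (I : finType) (c : nat -> I) (a : nat -> R) (j : I)
  (k : nat) : R := if c k == j then a k else 0.

(** Each sample coordinate enters only one linear form, so the expectation factorizes over the
    forms; [V j] is the variance of form [j]. The induction integrates the tail of the sample with
    the head value absorbed into the offset [b], leaving a one-dimensional integral in the head. *)
Lemma gexp_expR_sqr (I : finType) N (c : nat -> I) (a : nat -> R) (l b : I -> R)
    (K : R) (V : I -> R) :
  (forall j, V j = \sum_(k < N) class_weight c a j k ^+ 2) ->
  0 <= K -> (forall j, 0 < 1 - 2 * l j * V j) ->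
  let f s := (K * expR (\sum_j l j *
    (b j + \sum_(k < N) class_weight c a j k * s`_k) ^+ 2))%:E in
  gmeasurable N f /\
  gexp N f = (K * \prod_j ((Num.sqrt (1 - 2 * l j * V j))^-1 *
     expR (l j * b j ^+ 2 / (1 - 2 * l j * V j))))%:E.
Proof.
elim: N c a b K V => [|N IH] c a b K V VS K0 D0 /=.
  split=> //; congr (_ * _)%:E; rewrite expR_sum; apply: eq_bigr => j _.
  by rewrite VS !big_ord0 mulr0 subr0 sqrtr1 invr1 mul1r mulr1 addr0.
pose c' k := c k.+1; pose a' k := a k.+1; pose w := class_weight c a.
pose V' j := \sum_(k < N) class_weight c' a' j k ^+ 2.
have VE j : V j = w j 0%N ^+ 2 + V' j by rewrite VS big_ord_recl.
have V'0 j : 0 <= V' j by apply: sumr_ge0 => k _; exact: sqr_ge0.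
(* Dropping the head can only lower the variance, which settles positive [l j]; otherwise the
   quantity is at least 1. *)
have D'0 j : 0 < 1 - 2 * l j * V' j.
  have [l0|l0] := lerP (l j) 0.
    by have := mulr_le0_ge0 l0 (V'0 j); lra.
  have := D0 j; rewrite VE; have := mulr_ge0 (ltW l0) (sqr_ge0 (w j 0%N)); lra.
pose h x j := (Num.sqrt (1 - 2 * l j * V' j))^-1 *
     expR (l j * (b j + w j 0%N * x) ^+ 2 / (1 - 2 * l j * V' j)).
have IHx x := IH c' a' (fun j => b j + w j 0%N * x) K V' (fun=> erefl) K0 D'0.
have fE x : (fun s => (K * expR (\sum_j l j * (b j + \sum_(k < N.+1)
      class_weight c a j k * (x :: s)`_k) ^+ 2))%:E) =
    (fun s => (K * expR (\sum_j l j * (b j + w j 0%N * x + \sum_(k < N)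
      class_weight c' a' j k * s`_k) ^+ 2))%:E).
  apply/funext => s; congr (_ * expR _)%:E; apply: eq_bigr => j _.
  by rewrite big_ord_recl addrA.
(* Only form [j0] sees the head [x]: [l'] is the coefficient of its square once the tail is
   integrated, and [C] collects the factors free of [x]. *)
pose j0 := c 0%N; pose l' := l j0 / (1 - 2 * l j0 * V' j0).
pose C := K * ((Num.sqrt (1 - 2 * l j0 * V' j0))^-1 * \prod_(j | j != j0) h 0 j).
have hE x : K * \prod_j h x j = C * expR (l' * (b j0 + a 0%N * x) ^+ 2).
  have hp : \prod_(j | j != j0) h x j = \prod_(j | j != j0) h 0 j.
    apply: eq_bigr => j jj0; rewrite /h /w /class_weight eq_sym (negbTE jj0).
    by rewrite !mul0r.
  rewrite (bigD1 j0)//= hp /C {1}/h /w /class_weight eqxx.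
  by rewrite /l' (mulrAC (l j0)); ring.
have gE x : gexp N (fun s => (K * expR (\sum_j l j * (b j + \sum_(k < N.+1)
      class_weight c a j k * (x :: s)`_k) ^+ 2))%:E) =
    (C%:E * (expR (l' * (b j0 + a 0%N * x) ^+ 2))%:E)%E.
  by rewrite fE (IHx x).2 -EFinM -hE.
have mE : measurable_fun setT
    (fun x : R => (expR (l' * (b j0 + a 0%N * x) ^+ 2))%:E).
  by apply/measurable_EFinP; exact: measurable_expR_sqr.
split.
  split=> [x|]; first by rewrite fE; exact: (IHx x).1.
  by under eq_fun do rewrite gE; exact: emeasurable_funM.
under eq_integral do rewrite gE.
have C0 : 0 <= C.
  rewrite /C !mulr_ge0 ?invr_ge0 ?sqrtr_ge0//; apply: prodr_ge0 => j _.
  by rewrite mulr_ge0 ?invr_ge0 ?sqrtr_ge0 ?expR_ge0.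
rewrite ge0_integralZl//.
have VE0 : V j0 = a 0%N ^+ 2 + V' j0 by rewrite VE /w /class_weight eqxx.
have DE : 1 - 2 * l j0 * V j0 =
    (1 - 2 * l j0 * V' j0) * (1 - 2 * l' * a 0%N ^+ 2).
  by rewrite VE0 /l'; field; rewrite gt_eqF.
have D1 : 0 < 1 - 2 * l' * a 0%N ^+ 2.
  by have := D0 j0; rewrite DE pmulr_rgt0.
rewrite integral_normal_expR_sqr// -EFinM; congr EFin.
rewrite /C [in RHS](bigD1 j0)//= DE sqrtrM ?ltW// invfM.
rewrite [in RHS](eq_bigr (h 0)); last first.
  move=> j jj0; rewrite /h mulr0 addr0 VE /w /class_weight eq_sym.
  by rewrite (negbTE jj0) expr0n add0r.
rewrite (_ : l' * b j0 ^+ 2 / (1 - 2 * l' * a 0%N ^+ 2) = l j0 * b j0 ^+ 2 /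
   ((1 - 2 * l j0 * V' j0) * (1 - 2 * l' * a 0%N ^+ 2))); last first.
  have aux (x y z t : R) : x / y * z / t = x * z / (y * t) by rewrite invfM; ring.
  exact: aux.
by ring.
Qed.

(** With [x = u / (1 - u)] one has [1 + x = (1 - u)^-1], so this is the square root of
    [1 + x <= expR x]. *)
Lemma invr_sqrt_le_expR (u : R) : u < 1 ->
  (Num.sqrt (1 - u))^-1 <= expR (u / (1 - u) / 2).
Proof.
move=> u1; have D0 : 0 < 1 - u by rewrite subr_gt0.
rewrite -sqrtrV ?(ltW D0)// -[leRHS]ger0_norm ?expR_ge0// -sqrtr_sqr.
apply: ler_wsqrtr; rewrite expr2 -expRD -splitr.
apply: le_trans (expR_ge1Dx _).
by rewrite [leRHS](_ : _ = (1 - u)^-1)//; field; rewrite gt_eqF.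
Qed.

(** Moving the factor [(1 - 2 l)^(-1/2)] into the exponent produces the 1 in [1 + b j ^+ 2]. *)
Lemma gexp_expR_sqr_le (I : finType) N (c : nat -> I) (a : nat -> R)
    (l b : I -> R) (K : R) :
  (forall j, \sum_(k < N) class_weight c a j k ^+ 2 = 1) ->
  (forall j, 2 * l j < 1) ->
  let f s := (expR (K + \sum_j l j *
    (b j + \sum_(k < N) class_weight c a j k * s`_k) ^+ 2))%:E in
  gmeasurable N f /\
  (gexp N f <= (expR (K + \sum_j l j / (1 - 2 * l j) * (1 + b j ^+ 2)))%:E)%E.
Proof.
move=> V1 l1.
have [|||m e] := @gexp_expR_sqr I N c a l b (expR K) (fun=> 1).
- by move=> j; rewrite V1.
- exact: expR_ge0.
- by move=> j; rewrite mulr1 subr_gt0.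
split; first by under eq_fun do rewrite expRD.
under eq_fun do rewrite expRD.
rewrite e lee_fin expRD ler_wpM2l ?expR_ge0// expR_sum.
apply: ler_prod => j _; rewrite mulr1 mulr_ge0 ?invr_ge0 ?sqrtr_ge0 ?expR_ge0//=.
rewrite mulrDr mulr1 expRD; apply: ler_pM.
- by rewrite invr_ge0 sqrtr_ge0.
- exact: expR_ge0.
- apply: le_trans (invr_sqrt_le_expR (l1 j)) _.
  rewrite ler_expR le_eqVlt; apply/orP; left; apply/eqP.
  by field; rewrite gt_eqF// subr_gt0.
- by rewrite ler_expR mulrAC.
Qed.

End GaussianExpectation.

(** * The coordinates of [Z_n(tau)] as unit-variance linear forms in the noise *)

Section ContrastWeights.
Context {R : realType}.
Variables (n d tau : nat).
Hypothesis d_gt0 : (0 < d)%N.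
Hypothesis tau_bounds : (0 < tau < n)%N.

(** The flat index [k = i * d + j] is decoded by remainder into the column [j], and by quotient into
    the row [i]. *)
Definition column (k : nat) : 'I_d := Ordinal (ltn_pmod k d_gt0).

Lemma sum_column (F : nat -> R) (j : 'I_d) :
  \sum_(k < n * d) (if column k == j then F k else 0) =
  \sum_(i < n) F (i * d + j)%N.
Proof.
elim: n => [|m IH]; first by rewrite mul0n !big_ord0.
rewrite mulSnr big_split_ord /= IH big_ord_recr; congr (_ + _).
rewrite (bigD1 j)//= big1 ?addr0 => [|k kj].
  by rewrite (_ : column _ = j) ?eqxx//; apply/val_inj => /=; rewrite modnMDl modn_small.
case: eqP => // /(congr1 val) /=; rewrite modnMDl modn_small// => kE.
by move: kj; rewrite -val_eqE /= kE eqxx.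
Qed.

Lemma sum_before_const (x : R) : \sum_(i < n | (i < tau)%N) x = x * tau%:R.
Proof.
have /andP[_ /ltnW tn] := tau_bounds.
by rewrite -(big_ord_widen n (fun=> x) tn) sumr_const card_ord mulr_natr.
Qed.

Lemma sum_after_const (x : R) : \sum_(i < n | (tau <= i)%N) x = x * (n - tau)%:R.
Proof.
have /andP[_ /ltnW tn] := tau_bounds.
rewrite natrB// mulrBr -sum_before_const.
have -> : x * n%:R = \sum_(i < n) x by rewrite sumr_const card_ord mulr_natr.
rewrite [in RHS](bigID (fun i : 'I_n => (i < tau)%N)) /= addrC addrK.
by apply: eq_bigl => i; rewrite leqNgt.
Qed.

Definition contrast_scale : R := Num.sqrt (tau%:R * (n - tau)%:R / n%:R).

(** The coefficient of row [i] in the contrast [Z_n(tau)]. *)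
Definition contrast_weight (i : nat) : R :=
  if (i < tau)%N then contrast_scale / tau%:R
  else - (contrast_scale / (n - tau)%:R).

Definition coordinate_weight (k : nat) : R := contrast_weight (k %/ d).

Let tau_neq0 : tau%:R != 0 :> R.
Proof. by have /andP[t0 _] := tau_bounds; rewrite pnatr_eq0 -lt0n. Qed.

Let ntau_neq0 : (n - tau)%:R != 0 :> R.
Proof. by have /andP[_ tn] := tau_bounds; rewrite pnatr_eq0 -lt0n subn_gt0. Qed.

Let n_neq0 : n%:R != 0 :> R.
Proof.
have /andP[_ tn] := tau_bounds.
by rewrite pnatr_eq0 -lt0n (leq_ltn_trans _ tn).
Qed.

Lemma contrast_scale_sqr : contrast_scale ^+ 2 = n%:R * hfun R n tau.
Proof.
have /andP[_ /ltnW tn] := tau_bounds.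
rewrite sqr_sqrtr; first by rewrite /hfun natrB//; field.
by rewrite divr_ge0 ?mulr_ge0.
Qed.

(** The squares add up to [contrast_scale ^+ 2 * (1 / tau + 1 / (n - tau))], which the scale
    normalizes to 1. *)
Lemma coordinate_weight_norm (j : 'I_d) :
  \sum_(k < n * d) class_weight column coordinate_weight j k ^+ 2 = 1.
Proof.
transitivity (\sum_(k < n * d)
    (if column k == j then coordinate_weight k ^+ 2 else 0)).
  by apply: eq_bigr => k _; rewrite /class_weight; case: ifP => // _; rewrite expr0n.
rewrite (sum_column (fun k => coordinate_weight k ^+ 2)).
rewrite (bigID (fun i : 'I_n => (i < tau)%N)) /=.
under eq_bigr => i it.
  rewrite /coordinate_weight divnMDl// divn_small// addn0 /contrast_weight it.
  over.
rewrite sum_before_const.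
rewrite (eq_bigr (fun=> (contrast_scale / (n - tau)%:R) ^+ 2)); last first.
  move=> i it; rewrite /coordinate_weight divnMDl// divn_small// addn0.
  by rewrite /contrast_weight (negbTE it) sqrrN.
rewrite (eq_bigl (fun i : 'I_n => (tau <= i)%N)); last by move=> i; rewrite -leqNgt.
have /andP[_ /ltnW tn] := tau_bounds.
rewrite sum_after_const !exprMn contrast_scale_sqr /hfun.
move: ntau_neq0; rewrite natrB// => nt.
by field; rewrite ?nt ?tau_neq0 ?n_neq0.
Qed.

(** The baseline cancels between the two averages; the jump occurs only in the second, hence the
    minus sign. *)
Lemma Zn_mkX (theta Delta : 'rV[R]_d) (s : seq R) (j : 'I_d) :
  Zn (mkX n theta Delta tau s) tau 0 j =
  - (contrast_scale * Delta 0 j) +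
  \sum_(k < n * d) class_weight column coordinate_weight j k * s`_k.
Proof.
transitivity (contrast_scale * (tau%:R^-1 * (\sum_(i < n | (i < tau)%N)
     (theta 0 j + s`_(i * d + j)))
   - (n - tau)%:R^-1 * (\sum_(i < n | (tau <= i)%N)
     (theta 0 j + Delta 0 j + s`_(i * d + j))))).
  (* The one-based test [tau < i.+1] is [tau <= i], so the jump fills exactly the second block. *)
  rewrite /Zn !mxE !summxE; congr (_ * (_ * _ - _ * _)); apply: eq_bigr => i it.
    by rewrite !mxE ltnS leqNgt it /= addr0.
  by rewrite !mxE ltnS it.
rewrite !big_split/= !sum_before_const !sum_after_const.
rewrite [in RHS](eq_bigr (fun k : 'I_(n * d) =>
    if column k == j then coordinate_weight k * s`_k else 0)); last first.
  by move=> k _; rewrite /class_weight; case: ifP => // _; rewrite mul0r.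
rewrite (sum_column (fun k => coordinate_weight k * s`_k)).
rewrite [in RHS](bigID (fun i : 'I_n => (i < tau)%N)) /=.
rewrite [X in _ = _ + (X + _)](eq_bigr (fun i : 'I_n =>
    contrast_scale / tau%:R * s`_(i * d + j))); last first.
  move=> i it; rewrite /coordinate_weight divnMDl// divn_small// addn0.
  by rewrite /contrast_weight it.
rewrite [X in _ = _ + (_ + X)](eq_bigr (fun i : 'I_n =>
    - (contrast_scale / (n - tau)%:R) * s`_(i * d + j))); last first.
  move=> i it; rewrite /coordinate_weight divnMDl// divn_small// addn0.
  by rewrite /contrast_weight (negbTE it).
rewrite [X in _ = _ + (_ + X)](eq_bigl (fun i : 'I_n => (tau <= i)%N)); last first.
  by move=> i; rewrite -leqNgt.
rewrite -!mulr_sumr.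
by field; rewrite ntau_neq0 tau_neq0.
Qed.

End ContrastWeights.

(** * Nonasymptotic bounds on the two types of error *)

Section ErrorBounds.
Context {R : realType}.
Variables (n d p tau : nat) (theta : 'rV[R]_d).
Hypothesis d_gt0 : (0 < d)%N.
Hypothesis tau_bounds : (0 < tau < n)%N.

(** One weight per coordinate serves both tests: constant weights for the linear one, weights
    supported on a set for the scan. *)
Lemma gexp_chernoff (Delta : 'rV[R]_d) (l : 'I_d -> R) (K : R) :
  (forall j, 2 * l j < 1) ->
  let f s := (expR (K + \sum_j l j *
    Zn (mkX n theta Delta tau s) tau 0 j ^+ 2))%:E in
  gmeasurable (n * d) f /\
  (gexp (n * d) f <= (expR (K + \sum_j l j / (1 - 2 * l j) *
     (1 + n%:R * hfun R n tau * Delta 0 j ^+ 2)))%:E)%E.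
Proof.
move=> l1 f.
have [m e] := @gexp_expR_sqr_le R 'I_d (n * d) (column d_gt0)
  (coordinate_weight n d tau) l
  (fun j => - (contrast_scale n tau * Delta 0 j)) K
  (coordinate_weight_norm d_gt0 tau_bounds) l1.
rewrite /f; under eq_fun do under eq_bigr do rewrite (Zn_mkX d_gt0 tau_bounds).
split => //; apply: le_trans e _.
rewrite lee_fin ler_expR lerD2l le_eqVlt; apply/orP; left; apply/eqP.
by apply: eq_bigr => j _; rewrite sqrrN exprMn (contrast_scale_sqr tau_bounds).
Qed.

(** At this order the remainder [lam ^+ 2 * d] stays bounded while [lam * H * sqrt (2 d)] is still
    of order [H]. *)
Let lam : R := (4 * Num.sqrt d%:R)^-1.

Let sd_ge1 : 1 <= Num.sqrt d%:R :> R.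
Proof. by rewrite -[leLHS]sqrtr1 ler_wsqrtr// ler1n. Qed.

Let lam_gt0 : 0 < lam.
Proof. by rewrite invr_gt0 mulr_gt0// (lt_le_trans _ sd_ge1). Qed.

Let lam_le : lam <= 4^-1.
Proof.
rewrite lef_pV2 ?posrE ?mulr_gt0// ?(lt_le_trans _ sd_ge1)//.
by move: sd_ge1; lra.
Qed.

Let lamd : lam ^+ 2 * d%:R = 16^-1.
Proof.
have d0 : d%:R != 0 :> R by rewrite pnatr_eq0 -lt0n.
rewrite /lam exprVn exprMn sqr_sqrtr//.
by field.
Qed.

Let lamH (H : R) : 0 <= H -> H / 4 <= lam * (H * Num.sqrt (2 * d%:R)).
Proof.
move=> H0; rewrite sqrtrM// /lam.
have -> : (4 * Num.sqrt d%:R)^-1 * (H * (Num.sqrt 2 * Num.sqrt d%:R)) =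
    H / 4 * Num.sqrt (2 : R).
  by field; rewrite gt_eqF// (lt_le_trans _ sd_ge1).
by rewrite ler_peMr ?divr_ge0// -[leLHS]sqrtr1 ler_wsqrtr// ler1n.
Qed.

Lemma psi_lin_le (H : R) (X : 'M[R]_(n, d)) :
  psi_lin tau H X <= expR (- (lam * (d%:R + H * Num.sqrt (2 * d%:R))) +
    \sum_j lam * Zn X tau 0 j ^+ 2).
Proof.
rewrite /psi_lin /L_lin; case: ifPn => [|_]; last exact: expR_ge0.
rewrite ltr_pdivlMr ?sqrtr_gt0 ?mulr_gt0 ?ltr0n// => hH.
rewrite -[leLHS]expR0 ler_expR -mulr_sumr -/(sqnorm (Zn X tau)).
by rewrite addrC -mulrBr mulr_ge0 ?(ltW lam_gt0)//; lra.
Qed.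

Lemma psi_linC_le (H : R) (X : 'M[R]_(n, d)) :
  1 - psi_lin tau H X <= expR (lam * (d%:R + H * Num.sqrt (2 * d%:R)) +
    \sum_j (- lam) * Zn X tau 0 j ^+ 2).
Proof.
rewrite /psi_lin /L_lin; case: ifPn => [_|]; first by rewrite subrr expR_ge0.
rewrite -leNgt ler_pdivrMr ?sqrtr_gt0 ?mulr_gt0 ?ltr0n// => hH.
rewrite subr0 -[leLHS]expR0 ler_expR -mulr_sumr -/(sqnorm (Zn X tau)).
by rewrite mulNr -mulrBr mulr_ge0 ?(ltW lam_gt0)//; lra.
Qed.

Lemma sqnorm_projm (m : {set 'I_d}) (v : 'rV[R]_d) :
  sqnorm (projm m v) = \sum_j (j \in m)%:R * v 0 j ^+ 2.
Proof.
apply: eq_bigr => j _; rewrite mxE.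
by case: (j \in m); rewrite ?mul1r ?mul0r ?expr0n.
Qed.

(** A maximum above the threshold is attained by some support, whose exponential alone is at least
    1. *)
Lemma psi_scan_le (kL : R) (X : 'M[R]_(n, d)) : (0 < p)%N ->
  psi_scan p tau (kL / Num.sqrt (2 * p%:R)) X <=
  \sum_(m : {set 'I_d} | #|m| == p)
    expR (- ((p%:R + kL) / 4) + \sum_j (j \in m)%:R / 4 * Zn X tau 0 j ^+ 2).
Proof.
move=> p0; rewrite /psi_scan; set T := kL / _.
have s0 : 0 < Num.sqrt (2 * p%:R) :> R by rewrite sqrtr_gt0 mulr_gt0 ?ltr0n.
case: ifPn => [hT|_]; last by apply: sumr_ge0 => m _; exact: expR_ge0.
have [/existsP[m /andP[mp]]|] := boolP [exists m : {set 'I_d}, (#|m| == p) &&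
    (T < (sqnorm (projm m (Zn X tau)) - p%:R) / Num.sqrt (2 * p%:R))].
  rewrite ltr_pM2r ?invr_gt0// sqnorm_projm => hm.
  rewrite (bigD1 m)//= -[leLHS]addr0 lerD//; last first.
    by apply: sumr_ge0 => m' _; exact: expR_ge0.
  rewrite -[leLHS]expR0 ler_expR.
  under eq_bigr do rewrite mulrAC.
  by rewrite -mulr_suml; lra.
rewrite negb_exists => /forallP hm; exfalso; move: hT; rewrite ltNge => /negP; apply.
apply: bigmax_le => [|m mp]; first exact: leNye.
by rewrite lee_fin leNgt; have := hm m; rewrite mp.
Qed.

Lemma alpha_err_le (H kL : R) : (0 < p)%N -> 0 <= H ->
  (alpha_err theta tau
    (psi_star (n := n) p tau H (kL / Num.sqrt (2 * p%:R))) <=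
   (expR (4^-1 - H / 4) + 'C(d, p)%:R * expR ((p%:R - kL) / 4))%:E)%E.
Proof.
move=> p0 H0.
pose K1 := - (lam * (d%:R + H * Num.sqrt (2 * d%:R))).
pose K2 := - ((p%:R + kL) / 4).
have [|m1 e1] := @gexp_chernoff 0 (fun=> lam) K1.
  by move=> _; move: lam_le; lra.
have lm (m : {set 'I_d}) j : 2 * ((j \in m)%:R / 4 : R) < 1.
  by case: (j \in m) => /=; lra.
pose f1 s := (expR (K1 + \sum_j lam *
    Zn (mkX n theta 0 tau s) tau 0 j ^+ 2))%:E.
pose f2 (m : {set 'I_d}) s := (expR (K2 + \sum_j (j \in m)%:R / 4 *
    Zn (mkX n theta 0 tau s) tau 0 j ^+ 2))%:E.
have [||m2 e2] := @gexp_sum R (n * d) _ (index_enum {set 'I_d}) (fun m => #|m| == p) f2.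
- by move=> m s; rewrite lee_fin expR_ge0.
- by move=> m _; exact: (@gexp_chernoff 0 _ K2 (lm m)).1.
have f10 s : (0 <= f1 s)%E by rewrite lee_fin expR_ge0.
have f20 s : (0 <= \sum_(m : {set 'I_d} | #|m| == p) f2 m s)%E.
  by apply: sume_ge0 => m _; rewrite lee_fin expR_ge0.
have [_ e3] := gexpD f10 f20 m1 m2.
apply: le_trans (_ : _ <= gexp (n * d) (fun s => f1 s +
    \sum_(m : {set 'I_d} | #|m| == p) f2 m s))%E _.
  apply: le_gexp => s.
    rewrite lee_fin /psi_star le_max /psi_lin.
    by case: ifP => _; rewrite ?ler01 ?lexx.
  rewrite sumEFin -EFinD lee_fin /psi_star ge_max; apply/andP; split.
    rewrite -[leLHS]addr0 lerD ?psi_lin_le//.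
    by apply: sumr_ge0 => m _; exact: expR_ge0.
  rewrite -[leLHS]add0r lerD ?expR_ge0//; exact: psi_scan_le.
rewrite e3 e2 EFinD; apply: leeD.
  apply: le_trans e1 _; rewrite lee_fin ler_expR.
  rewrite (eq_bigr (fun=> lam / (1 - 2 * lam))); last first.
    by move=> j _; rewrite mxE expr0n mulr0 addr0 mulr1.
  rewrite sumr_const card_ord -[_ *+ d]mulr_natr.
  have D0 : 2^-1 <= 1 - 2 * lam by move: lam_le; lra.
  (* The terms of first order in [lam * d] cancel, and the second-order rest is at most 1/4 because
     [lam <= 1/4]. *)
  have -> : K1 + lam / (1 - 2 * lam) * d%:R = 2 * (lam ^+ 2 * d%:R) / (1 - 2 * lam)
     - lam * (H * Num.sqrt (2 * d%:R)).
    by rewrite /K1; field; lra.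
  have := lamH H0; rewrite lamd.
  have : 2 * 16^-1 / (1 - 2 * lam) <= 4^-1.
    by rewrite ler_pdivrMr; lra.
  lra.
apply: le_trans (_ : _ <= \sum_(m : {set 'I_d} | #|m| == p)
    (expR ((p%:R - kL) / 4))%:E)%E _; last first.
  rewrite sumEFin lee_fin sumr_const.
  have := card_draws 'I_d p; rewrite card_ord => <-; rewrite cardsE.
  by rewrite mulr_natl.
apply: lee_sum => m mp; apply: le_trans (@gexp_chernoff 0 _ K2 (lm m)).2 _.
(* At [l = 1/4], [l / (1 - 2 l) = 1/2]: the support contributes [p / 2], and the exponent is
   [p / 2 - (p + kL) / 4]. *)
rewrite lee_fin ler_expR (eq_bigr (fun j => 2^-1 * (j \in m)%:R)); last first.
  move=> j _; rewrite mxE expr0n mulr0 addr0 mulr1.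
  by case: (j \in m) => /=; [field; lra|rewrite !mul0r mulr0].
have cm : (\sum_j (j \in m) = #|m|)%N.
  by rewrite -sum1_card [RHS]big_mkcond; apply: eq_bigr => j _; case: (j \in m).
by rewrite -mulr_sumr -natr_sum cm (eqP mp) /K2; lra.
Qed.

Lemma sqr_le_sqnorm (r : R) (v : 'rV[R]_d) : 0 <= r -> r <= enorm v ->
  r ^+ 2 <= sqnorm v.
Proof.
move=> r0; rewrite /enorm => h.
have v0 : 0 <= sqnorm v by apply: sumr_ge0 => j _; exact: sqr_ge0.
by rewrite -(sqr_sqrtr v0) lerXn2r// ?nnegrE ?sqrtr_ge0.
Qed.

(** The negative weight [- lam] makes the exponential large on acceptance. A signal of at least
    twice the threshold term [W] still exceeds it by [W / 3] after division by [1 + 2 lam]. *)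
Lemma beta_err_le (H T r : R) : 0 <= H -> 0 <= r ->
  2 * (H * Num.sqrt (2 * d%:R)) <= r ^+ 2 * n%:R * hfun R n tau ->
  (beta_err theta tau (psi_star (n := n) p tau H T) (Theta_p p r) <=
   (expR (8^-1 - H / 12))%:E)%E.
Proof.
move=> H0 r0 hr; apply: ge_ereal_sup => _ [Delta [_ rD] <-].
pose K := lam * (d%:R + H * Num.sqrt (2 * d%:R)).
have [|_ e] := @gexp_chernoff Delta (fun=> - lam) K.
  by move=> _; move: lam_gt0; lra.
apply: le_trans (le_trans _ e) _.
  apply: le_gexp => s; rewrite lee_fin.
    rewrite subr_ge0 ge_max /psi_lin /psi_scan.
    by apply/andP; split; case: ifP.
  apply: le_trans (psi_linC_le _ _); rewrite lerD2l lerN2 /psi_star.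
  by rewrite le_max lexx.
rewrite lee_fin ler_expR.
set nh := n%:R * hfun R n tau.
have nh0 : 0 <= nh by rewrite /nh -(contrast_scale_sqr tau_bounds) sqr_ge0.
rewrite -mulr_sumr big_split/= -mulr_sumr -/(sqnorm Delta) sumr_const card_ord.
have D0 : 0 < 1 + 2 * lam by move: lam_gt0; lra.
have rS : r ^+ 2 * nh <= nh * sqnorm Delta.
  by rewrite mulrC ler_wpM2l// sqr_le_sqnorm.
set S := nh * sqnorm Delta in rS *; set W := H * _ in hr *.
have hS : 2 * W <= S by apply: le_trans hr _; rewrite -mulrA.
have W0 : 0 <= W by rewrite mulr_ge0 ?sqrtr_ge0.
rewrite (_ : _ + _ = 2 * (lam ^+ 2 * d%:R) / (1 + 2 * lam) +
    lam * (W - S / (1 + 2 * lam))); last first.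
  by rewrite /K -/W; field; lra.
rewrite lamd.
have h1 : 2 * 16^-1 / (1 + 2 * lam) <= 8^-1.
  by rewrite ler_pdivrMr//; move: lam_gt0; lra.
(* Since [1 + 2 lam <= 3/2] and [S >= 2 W], the quotient is at least [4 W / 3]. *)
have h2 : W - S / (1 + 2 * lam) <= - (W / 3).
  suff : 4 / 3 * W <= S / (1 + 2 * lam) by lra.
  rewrite ler_pdivlMr//; apply: le_trans hS.
  have : W * lam <= W * 4^-1 by rewrite ler_wpM2l.
  lra.
have := ler_wpM2l (ltW lam_gt0) h2.
have := lamH H0; rewrite -/W.
lra.
Qed.

(** The supremum of an empty set is [-oo], so a member of the alternative is exhibited: the vector
    equal to [r] on the first [p] coordinates. *)
Lemma beta_err_ge0 (H T r : R) : (0 < p <= d)%N -> 0 <= r ->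
  (0 <= beta_err theta tau (psi_star (n := n) p tau H T) (Theta_p p r))%E.
Proof.
move=> /andP[p0 pd] r0.
have pos D : (0 <= Eexp theta D tau (fun X => (1 - psi_star (n := n) p tau H T X)%R))%E.
  apply: gexp_ge0 => s; rewrite lee_fin subr_ge0 ge_max /psi_lin /psi_scan.
  by apply/andP; split; case: ifP.
pose m := [set j : 'I_d | (j < p)%N]%SET.
pose D : 'rV[R]_d := \row_j (if j \in m then r else 0).
apply: le_trans (pos D) _; apply: ereal_sup_ubound; exists D => //; split.
  exists m; split; last by move=> j jm; rewrite mxE (negbTE jm).
  rewrite -sum1_card (eq_bigl (fun j : 'I_d => (j < p)%N)); last by move=> j; rewrite inE.
  by rewrite -(big_ord_widen d (fun=> 1%N) pd) sum1_card card_ord.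
rewrite /enorm -[leLHS]ger0_norm// -sqrtr_sqr; apply: ler_wsqrtr.
rewrite /sqnorm (bigD1 (Ordinal d_gt0))//= mxE inE /= p0 lerDl.
by apply: sumr_ge0 => j _; exact: sqr_ge0.
Qed.

End ErrorBounds.

(** * Limits, and estimates on binomials and constants *)

Section Asymptotics.
Context {R : realType}.

Lemma cvg_expR_affine (a c : R) (u : nat -> R) : 0 < c ->
  u @ \oo --> +oo -> (fun d => expR (a - c * u d)) @ \oo --> 0.
Proof.
move=> c0 uoo; have voo : (fun d => c * u d - a) @ \oo --> +oo.
  apply/cvgryPge => A; move/cvgryPge: uoo => /(_ ((A + a) / c)).
  apply: filterS => d; rewrite ler_pdivrMr// => h; lra.
have := cvg_comp _ _ voo (@cvgr_expR R).
by apply: cvg_trans; apply: near_eq_cvg; near=> d; rewrite /= opprB.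
Unshelve. all: by end_near. Qed.

Lemma cvg_ln_pinfty (u : nat -> R) :
  u @ \oo --> +oo -> (fun d => ln (u d)) @ \oo --> +oo.
Proof.
move=> uoo; apply/cvgryPge => A; move/cvgryPge: uoo => /(_ (expR A)).
apply: filterS => d h; rewrite -[A]expRK ler_ln// ?posrE ?expR_gt0//.
exact: lt_le_trans (expR_gt0 A) h.
Qed.

(** The limsup is an infimum of suprema over eventual sets, so one of these suprema lies below
    [c]. *)
Lemma limn_esup_lt_near (u : nat -> \bar R) (c : \bar R) :
  (limn_esup u < c)%E -> \forall d \near \oo, (u d < c)%E.
Proof.
rewrite /limn_esup limf_esupE => /ereal_inf_lt[_ [V Voo <-] Vc].
apply: filterS Voo => d Vd; apply: le_lt_trans Vc.
by apply: ereal_sup_ubound; exists d.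
Qed.

(** Induction through [C(d+1, p+2) = (d+1) / (p+2) * C(d, p+1)], with [(d+1) / (p+2) <= d / (p+1)]
    when [p+1 <= d]. *)
Lemma div_expn_le_bin (d p : nat) : (0 < p <= d)%N ->
  (d%:R / p%:R) ^+ p <= 'C(d, p)%:R :> R.
Proof.
case: p => // p; elim: p d => [|p IH] [//|d] pd.
  by rewrite bin1 divr1 expr1.
have E : 'C(d.+1, p.+2)%:R = d.+1%:R / p.+2%:R * 'C(d, p.+1)%:R :> R.
  have /(congr1 (fun k => k%:R : R)) := mul_bin_diag d.+1 p.+1.
  by rewrite !natrM /= => h; rewrite mulrAC h mulrAC divff ?mul1r// pnatr_eq0.
rewrite E exprS ler_wpM2l ?divr_ge0//.
apply: le_trans (IH d pd); rewrite lerXn2r ?nnegrE ?divr_ge0//.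
rewrite ler_pdivrMr ?ltr0n// mulrAC ler_pdivlMr ?ltr0n//.
rewrite -!natrM ler_nat mulSn (mulnS d p.+1) leq_add2r.
by move: pd => /=; rewrite ltnS.
Qed.

(** Given [ln 2 < 1], this amounts to [ln 2 >= 1/2], a consequence of [expR (- 1/2) >= 1 - 1/2]. *)
Lemma two_div_1Bln2_ge4 : 4 <= 2 / (1 - ln 2) :> R.
Proof.
have l1 : ln 2 < 1 :> R.
  rewrite -[ltRHS]expRK ltr_ln ?posrE ?expR_gt0//.
  by have := @expR_gt1Dx R 1 (oner_neq0 _); lra.
have l2 : 2^-1 <= ln 2 :> R.
  rewrite -[leLHS]expRK ler_ln ?posrE ?expR_gt0//.
  rewrite -[leRHS]invrK -[leLHS]invrK -expRN lef_pV2 ?posrE ?invr_gt0 ?expR_gt0//.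
  by have := @expR_ge1Dx R (- 2^-1); lra.
by rewrite ler_pdivlMr; lra.
Qed.

(* The union bound over the supports is absorbed because
   [kappa / 4 > 1] and [ln 'C(d, p) >= p * ln (d / p)]. *)
Lemma scan_union_bound (kappa delta : R) (d p : nat) :
  4 < kappa -> 0 < delta -> (0 < p <= d)%N ->
  4^-1 <= (kappa / 4 - 1) * ln (d%:R / p%:R) ->
  'C(d, p)%:R * expR ((p%:R - kappa * ln ((1 + delta) * 'C(d, p)%:R)) / 4) <=
  expR (4^-1 - (kappa / 4 - 1) * ln (d%:R / p%:R)).
Proof.
move=> k4 de0 /[dup] pd /andP[p0 pled] hx.
have C0 : 0 < 'C(d, p)%:R :> R by rewrite ltr0n bin_gt0.
have dp0 : 0 < d%:R / p%:R :> R by rewrite divr_gt0 ?ltr0n// (leq_trans p0).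
have C1 : 'C(d, p)%:R <= (1 + delta) * 'C(d, p)%:R.
  by rewrite ler_peMl ?(ltW C0)//; lra.
set L := ln _; set x := ln (_ / _) in hx *.
have CL : 'C(d, p)%:R <= expR L by rewrite lnK// posrE (lt_le_trans C0).
have xL : p%:R * x <= L.
  have dC0 : (1 + delta) * 'C(d, p)%:R \is Num.pos by exact: lt_le_trans C0 C1.
  rewrite mulr_natl -lnXn// ler_ln ?posrE ?exprn_gt0//.
  exact: le_trans (div_expn_le_bin pd) C1.
apply: le_trans (ler_wpM2r (expR_ge0 _) CL) _.
rewrite -expRD ler_expR.
set g := kappa / 4 - 1 in hx *.
have g0 : 0 < g by rewrite /g; lra.
have p1 : 1 <= p%:R :> R by rewrite ler1n.
have h1 := ler_wpM2l (ltW g0) xL.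
(* This lowers the exponent bound [p * (1/4 - g * x)] to its value at [p = 1]. *)
have h2 : 0 <= (p%:R - 1) * (g * x - 4^-1) by rewrite mulr_ge0// subr_ge0.
have -> : L + (p%:R - kappa * L) / 4 = p%:R / 4 - g * L by rewrite /g; field.
lra.
Qed.

End Asymptotics.

(** * Convergence of the total risk to zero *)

Theorem theorem1 (R : realType) (kappa delta : R)
  (n p tau : nat -> nat) (r H : nat -> R) (theta : forall d : nat, 'rV[R]_d) :
  2 / (1 - ln 2) < kappa ->
  0 < delta ->
  (* model *)
  (forall d, (2 <= n d)%N) ->
  (forall d, (0 < d)%N -> (1 <= p d <= d)%N) ->
  (forall d, (0 < tau d < n d)%N) ->
  (forall d, 0 < r d) ->
  (* (A1) *)
  (fun d => (n d)%:R : R) @ \oo --> +oo ->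
  (* (A2) *)
  (fun d => (p d)%:R : R) @ \oo --> +oo ->
  (fun d => d%:R / (p d)%:R : R) @ \oo --> +oo ->
  (* condition on r *)
  ((fun d => r d ^+ 2 * (n d)%:R * (hfun R (n d) (tau d) : R) / Num.sqrt d%:R)
      @ \oo --> +oo
   \/ (kappa%:E < limn_einf (fun d =>
         (r d ^+ 2 * (n d)%:R * (hfun R (n d) (tau d) : R)
           / ((p d)%:R * ln (d%:R / (p d)%:R)))%:E))%E) ->
  (* threshold H *)
  H @ \oo --> +oo ->
  (forall d, Num.sqrt (kappa / 2 * ln d%:R) <= H d) ->
  (limn_esup (fun d =>
       (H d * Num.sqrt (2 * d%:R) / (r d ^+ 2 * (n d)%:R * (hfun R (n d) (tau d) : R)))%:E)
     < (Num.sqrt 2 - 1)%:E)%E ->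
  (fun d =>
     gamma_err (n := n d) (theta d) (tau d)
       (psi_star (p d) (tau d) (H d)
          (kappa / Num.sqrt (2 * (p d)%:R) * ln ((1 + delta) * ('C(d, p d))%:R)))
       (Theta_p (p d) (r d)))
    @ \oo --> 0%E.
Proof.
move=> kap de0 n2 pd tn r0 _ _ dpoo _ Hoo Hge Hsup.
have k4 : 4 < kappa by exact: le_lt_trans two_div_1Bln2_ge4 kap.
have g0 : 0 < kappa / 4 - 1 by lra.
have xoo := cvg_ln_pinfty dpoo.
have H0 d : 0 <= H d by exact: le_trans (sqrtr_ge0 _) (Hge d).
(* In order: type I error of the linear test, type I error of the scan test, type II error. *)
pose u d := expR (4^-1 - 4^-1 * H d) +
  expR (4^-1 - (kappa / 4 - 1) * ln (d%:R / (p d)%:R)) +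
  expR (8^-1 - 12^-1 * H d).
have u0 : u @ \oo --> 0.
  rewrite -[X in _ --> X]addr0 -[X in _ --> X + _]addr0.
  by apply: cvgD; [apply: cvgD|]; apply: cvg_expR_affine.
apply: (@squeeze_cvge _ _ _ _ (fun=> 0%E) _ (fun d => (u d)%:E)).
- have d0 : \forall d \near \oo, (0 < d)%N by exact: nbhs_infty_gt.
  have Hl := limn_esup_lt_near Hsup.
  (* Beyond this level of [ln (d / p)] the bound [scan_union_bound] applies. *)
  move/cvgryPge: xoo => /(_ (4^-1 / (kappa / 4 - 1))).
  apply: filter_app; apply: filterS2 d0 Hl => d d0 Hl.
  rewrite ler_pdivrMr// [X in _ <= X -> _]mulrC => hx.
  have [pd0 tnd] := (pd d d0, tn d).
  have /andP[p0 _] := pd0.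
  have /andP[t0 tltn] := tnd.
  have n0 : 0 < (n d)%:R :> R by rewrite ltr0n (leq_trans _ (n2 d)).
  have h0 : 0 < hfun R (n d) (tau d).
    have t0' : 0 < (tau d)%:R :> R by rewrite ltr0n.
    rewrite /hfun mulr_gt0 ?divr_gt0//.
    by rewrite subr_gt0 ltr_pdivrMr// mul1r ltr_nat.
  have rho0 : 0 < r d ^+ 2 * (n d)%:R * hfun R (n d) (tau d).
    by rewrite mulr_gt0// mulr_gt0// exprn_gt0.
  have hr : 2 * (H d * Num.sqrt (2 * d%:R)) <=
      r d ^+ 2 * (n d)%:R * hfun R (n d) (tau d).
    move: Hl; rewrite lte_fin ltr_pdivrMr// => Hl.
    (* From [2 <= (3/2)^2]; this turns the limsup bound into the factor 2 required by
       [beta_err_le]. *)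
    have s2 : Num.sqrt (2 : R) - 1 <= 2^-1.
      rewrite lerBlDr -[leRHS]ger0_norm; last by lra.
      by rewrite -sqrtr_sqr; apply: ler_wsqrtr; lra.
    have := ler_wpM2r (ltW rho0) s2; lra.
  apply/andP; split.
    rewrite /gamma_err adde_ge0// ?beta_err_ge0 ?(ltW (r0 d))//.
    apply: gexp_ge0 => s; rewrite lee_fin /psi_star le_max /psi_lin.
    by case: ifP => _; rewrite ?ler01 ?lexx.
  rewrite /gamma_err /u EFinD; apply: leeD; last first.
    by rewrite [12^-1 * _]mulrC; apply: beta_err_le => //; exact: ltW.
  rewrite [_ / _ * _]mulrAC.
  apply: le_trans (alpha_err_le _ _ _ _ _ _) _ => //.
  rewrite lee_fin [4^-1 * _]mulrC lerD2l.
  exact: scan_union_bound.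
- exact: cvg_cst.
- by apply: cvg_EFin => //; exact: nearW.
Qed.
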